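(* Let $N\ge2$. The graph-coloring subshift $\mathcal{C}_3\subseteq\{0,1,2\}^{\mathrm{BS}(1,N)}$ admits a frozen coloring, and hence is not strongly irreducible.
   Context: $\mathrm{BS}(1,N)=\langle a,b\mid bab^{-1}=a^N\rangle$. The graph-coloring subshift in three colors is $$\mathcal{C}_3=\{x\in\{0,1,2\}^{\mathrm{BS}(1,N)} : x_g\ne x_{gs}\text{ for all } g\in \mathrm{BS}(1,N),\ s\in\{a,b\}\}.$$ A configuration $x\in\mathcal{C}_3$ is a frozen coloring if every $y\in\mathcal{C}_3$ for which there is a non-empty finite set $F\subseteq\mathrm{BS}(1,N)$ with $x|_{F^c}=y|_{F^c}$ satisfies $y=x$. A pattern is an element $p\in\mathcal{A}^F$ with $F$ a finite subset of the group; $\mathrm{supp}(p)=F$; it is globally admissible in a subshift $X$ if $p=x|_F$ for some $x\in X$; $[p]$ denotes the set of configurations in $X$ which restrict to $p$ on $\mathrm{supp}(p)$. A subshift $X\subseteq\mathcal{A}^{\Lambda}$ over a group $\Lambda$ is strongly irreducible if there is a finite $F\subseteq\Lambda$ such that for all globally admissible patterns $p,q$ in $X$ with $\mathrm{supp}(p)\cap(\mathrm{supp}(q)\cdot F)=\varnothing$ we have $[p]\cap[q]\neq\varnothing$. *)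

(* Defs.v *)
From HB Require Import structures.
From mathcomp Require Import all_boot finmap.
From mathcomp Require Import boolp classical_sets.

Set Implicit Arguments.
Unset Strict Implicit.
Unset Printing Implicit Defensive.

Local Open Scope quotient_scope.
Local Open Scope classical_set_scope.
Local Open Scope group_scope.

(* Group presentations.  A word over I is a sequence of letters (i, e), where *)
(* (i, false) is the generator i and (i, true) is its formal inverse.         *)

Definition word (I : choiceType) : Type := seq (I * bool).

Definition letter_inv (I : choiceType) (l : I * bool) : I * bool :=
  (l.1, ~~ l.2).

Definition word_inv (I : choiceType) (w : word I) : word I :=
  rev (map (@letter_inv I) w).

(* The smallest congruence on words that cancels adjacent inverse letters and *)
(* identifies u with v whenever the relation u = v is in rels.                *)
Inductive pres_eq (I : choiceType) (rels : word I -> word I -> Prop) :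
  word I -> word I -> Prop :=
| PresRel u v of rels u v : pres_eq rels u v
| PresCancel l : pres_eq rels [:: l; letter_inv l] [::]
| PresCat u u' v v' of pres_eq rels u u' & pres_eq rels v v' :
    pres_eq rels (u ++ v) (u' ++ v')
| PresRefl u : pres_eq rels u u
| PresSym u v of pres_eq rels u v : pres_eq rels v u
| PresTrans u v w of pres_eq rels u v & pres_eq rels v w : pres_eq rels u w.

Definition pres_eqb (I : choiceType) (rels : word I -> word I -> Prop) :
  rel (word I) := fun u v => `[< pres_eq rels u v >].

Lemma pres_eqb_refl (I : choiceType) (rels : word I -> word I -> Prop) :
  reflexive (pres_eqb rels).
Proof. by move=> u; apply/asboolP; exact: PresRefl. Qed.

Lemma pres_eqb_sym (I : choiceType) (rels : word I -> word I -> Prop) :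
  symmetric (pres_eqb rels).
Proof.
by move=> u v; apply/asboolP/asboolP; exact: PresSym.
Qed.

Lemma pres_eqb_trans (I : choiceType) (rels : word I -> word I -> Prop) :
  transitive (pres_eqb rels).
Proof.
move=> v u w /asboolP uv /asboolP vw; apply/asboolP; exact: PresTrans uv vw.
Qed.

Canonical pres_equiv (I : choiceType) (rels : word I -> word I -> Prop) :=
  EquivRel (pres_eqb rels) (pres_eqb_refl rels) (pres_eqb_sym rels)
           (@pres_eqb_trans I rels).

Definition presented (I : choiceType) (rels : word I -> word I -> Prop) :
  Type := {eq_quot (pres_equiv rels)}.

HB.instance Definition _ (I : choiceType) (rels : word I -> word I -> Prop) :=
  Choice.on (presented rels).

Definition pclass (I : choiceType) (rels : word I -> word I -> Prop)
  (w : word I) : presented rels := \pi_({eq_quot (pres_equiv rels)}) w.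

Definition prepr (I : choiceType) (rels : word I -> word I -> Prop)
  (x : presented rels) : word I := repr (x : {eq_quot (pres_equiv rels)}).

Lemma preprK (I : choiceType) (rels : word I -> word I -> Prop) :
  cancel (@prepr I rels) (@pclass I rels).
Proof. exact: reprK. Qed.

Lemma pclassP (I : choiceType) (rels : word I -> word I -> Prop) (u v : word I) :
  pclass rels u = pclass rels v <-> pres_eq rels u v.
Proof.
split=> [/eqP|uv].
- by rewrite /pclass eqmodE => /asboolP.
- by apply/eqP; rewrite /pclass eqmodE; apply/asboolP.
Qed.

Definition pone (I : choiceType) (rels : word I -> word I -> Prop) :
  presented rels := pclass rels [::].

Definition pmul (I : choiceType) (rels : word I -> word I -> Prop)
  (x y : presented rels) : presented rels := pclass rels (prepr x ++ prepr y).

Definition pinv (I : choiceType) (rels : word I -> word I -> Prop)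
  (x : presented rels) : presented rels := pclass rels (word_inv (prepr x)).

Lemma prepr_class (I : choiceType) (rels : word I -> word I -> Prop)
  (u : word I) : pres_eq rels (prepr (pclass rels u)) u.
Proof. by apply/pclassP; rewrite preprK. Qed.

Lemma pmul_class (I : choiceType) (rels : word I -> word I -> Prop)
  (u v : word I) : pmul (pclass rels u) (pclass rels v) = pclass rels (u ++ v).
Proof. by apply/pclassP; apply: PresCat; exact: prepr_class. Qed.

Lemma pres_mulwV (I : choiceType) (rels : word I -> word I -> Prop)
  (w : word I) : pres_eq rels (w ++ word_inv w) [::].
Proof.
elim: w => [|l w IH]; first exact: PresRefl.
rewrite /word_inv /= rev_cons -cats1 -cat_cons catA -/(word_inv w).
rewrite -cat1s -(catA [:: l]) -catA.
apply: (PresTrans (v := [:: l] ++ [:: letter_inv l])); last exact: PresCancel.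
apply: PresCat; first exact: PresRefl.
rewrite -[X in pres_eq _ _ X]cat0s.
by apply: PresCat => //; exact: PresRefl.
Qed.

Lemma word_invK (I : choiceType) : involutive (@word_inv I).
Proof.
move=> w; rewrite /word_inv map_rev revK -map_comp map_id_in // => -[i e] _.
by rewrite /= /letter_inv /= negbK.
Qed.

Lemma pmulA (I : choiceType) (rels : word I -> word I -> Prop) :
  associative (@pmul I rels).
Proof.
move=> x y z; rewrite -(preprK x) -(preprK y) -(preprK z).
by rewrite !pmul_class catA.
Qed.

Lemma pmul1 (I : choiceType) (rels : word I -> word I -> Prop) :
  left_id (@pone I rels) (@pmul I rels).
Proof. by move=> x; rewrite -(preprK x) pmul_class. Qed.

Lemma pmulr1 (I : choiceType) (rels : word I -> word I -> Prop) :
  right_id (@pone I rels) (@pmul I rels).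
Proof. by move=> x; rewrite -(preprK x) pmul_class cats0. Qed.

Lemma pmulV (I : choiceType) (rels : word I -> word I -> Prop) :
  left_inverse (@pone I rels) (@pinv I rels) (@pmul I rels).
Proof.
move=> x; rewrite -{2}(preprK x) pmul_class; apply/pclassP.
by rewrite -{2}(word_invK (prepr x)); exact: pres_mulwV.
Qed.

Lemma pmulrV (I : choiceType) (rels : word I -> word I -> Prop) :
  right_inverse (@pone I rels) (@pinv I rels) (@pmul I rels).
Proof.
by move=> x; rewrite -{1}(preprK x) pmul_class; apply/pclassP; exact: pres_mulwV.
Qed.

HB.instance Definition _ (I : choiceType) (rels : word I -> word I -> Prop) :=
  isGroup.Build (presented rels) (@pmulA I rels) (@pmul1 I rels)
    (@pmulr1 I rels) (@pmulV I rels) (@pmulrV I rels).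

Definition pgen (I : choiceType) (rels : word I -> word I -> Prop) (i : I) :
  presented rels := pclass rels [:: (i, false)].

(* In BS(1, N), the generator a is encoded by false and b by true, so that    *)
(* the only relation is b a b^-1 = a ^ N.                                     *)
Definition BS_rels (N : nat) (u v : word bool) : Prop :=
  u = [:: (true, false); (false, false); (true, true)] /\
  v = nseq N (false, false).

Definition BS (N : nat) : groupType := presented (BS_rels N).

Definition BSa (N : nat) : BS N := pgen (BS_rels N) false.
Definition BSb (N : nat) : BS N := pgen (BS_rels N) true.

Lemma BS_relation (N : nat) : BSb N * BSa N * (BSb N)^-1 = BSa N ^+ N.
Proof.
have mulE u v : pclass (BS_rels N) u * pclass (BS_rels N) v
              = pclass (BS_rels N) (u ++ v) by exact: pmul_class.
have bV : (BSb N)^-1 = pclass (BS_rels N) [:: (true, true)].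
  apply: (mulgI (BSb N)); rewrite mulgV mulE; apply/esym/pclassP.
  exact: (PresCancel _ (true, false)).
have aX n : BSa N ^+ n = pclass (BS_rels N) (nseq n (false, false)).
  by elim: n => [|n IH]; rewrite ?expg0 // expgS IH mulE.
rewrite bV aX /BSa /BSb /pgen (mulE [:: _]) mulE.
by apply/pclassP; apply: PresRel; split.
Qed.

(* Symbolic dynamics over a group G with finite alphabet A.  A pattern p is a *)
(* finite map from G to A, whose support is domf p.                           *)

Definition restrict (G : groupType) (A : finType) (x : G -> A)
  (F : {fset G}) : {fmap G -> A} := [fmap g : F => x (val g)].

Definition globally_admissible (G : groupType) (A : finType)
  (X : set (G -> A)) (p : {fmap G -> A}) : Prop :=
  exists2 x, X x & p = restrict x (domf p).

Definition cylinder (G : groupType) (A : finType)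
  (X : set (G -> A)) (p : {fmap G -> A}) : set (G -> A) :=
  [set x | X x /\ restrict x (domf p) = p].

Definition fset_mul (G : groupType) (E F : {fset G}) : {fset G} :=
  [fset g * h | g in E, h in F]%fset.

Definition strongly_irreducible (G : groupType) (A : finType)
  (X : set (G -> A)) : Prop :=
  exists F : {fset G}, forall p q : {fmap G -> A},
    globally_admissible X p -> globally_admissible X q ->
    (domf p `&` fset_mul (domf q) F = fset0)%fset ->
    cylinder X p `&` cylinder X q !=set0.

Definition C3 (N : nat) : set (BS N -> 'I_3) :=
  [set x | forall g s : BS N, s \in [:: BSa N; BSb N] -> x g <> x (g * s)].

Definition frozen_coloring (N : nat) (x : BS N -> 'I_3) : Prop :=
  C3 x /\
  forall y : BS N -> 'I_3, C3 y ->
    (exists2 F : {fset BS N}, F != fset0 &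
       forall g, g \notin F -> x g = y g) ->
    y = x.

(* Main.v *)
Require Import Defs.
From mathcomp Require Import all_boot finmap.
From mathcomp Require Import boolp classical_sets.
From mathcomp Require Import all_order all_algebra.

(**
A vertex of a proper 3-coloring that sees two different colors on its neighbors
has its own color forced by them.  So a coloring is frozen as soon as every
vertex can be assigned two neighbors of different colors in such a way that
every non-empty finite set [F] has a member whose two assigned neighbors lie
outside [F].  The vertex [g] is assigned its left neighbor [g a^-1] and one of
its vertical neighbors [g b] and [g b^-1], the choice between these two being
constant along the column [g <b>].  Such a member of [F] exists because BS(1,N)
acts on the rational line by [a : t |-> t + 1] and [b : t |-> N t]: the position
[g . 0] increases strictly under right multiplication by [a] and is unchanged
by [b].  Take [g] in [F] of least position; then [g a^-1] is not in [F].  Among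
these, take the highest or the lowest one in its column, according to the
vertical choice made there (BS_position_height, frozen_of_forcing).

It remains to find a coloring with such an assignment.
- For [N >= 3], send [a] to 1 and [b] to 0 to get a morphism [p] onto Z/(N-1),
  which respects [b a b^-1 = a^N] because [N = 1] in Z/(N-1).  Put
  [x g = ht g + c (p g)] modulo 3, where [ht] counts the exponent of [b] and [c]
  is a proper 3-coloring of the cycle of length [N - 1 >= 2].  The colors above
  and below [g] are [x g + 1] and [x g - 1], and the color on the left is
  different from [x g], so it differs from one of these two; which one depends
  only on [p g], which is constant along columns.
- For [N = 2] that cycle degenerates to a point; instead, a coloring factors
  through the symmetric group of degree 3, where [a] is a 3-cycle and [b] a
  transposition.

Finally, a frozen coloring [x] contradicts strong irreducibility: gluing [x] on
the boundary of a large finite set to a different color at the identity, and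
extending by [x] outside, gives a finite modification of [x]
(frozen_not_strongly_irreducible).
*)

Set Implicit Arguments.
Unset Strict Implicit.
Unset Printing Implicit Defensive.

Import Order.TTheory GRing.Theory Num.Theory.

Local Open Scope group_scope.

(** * Maps out of BS(1,N) from right actions *)

Section RightAction.

Variables (N : nat) (S : Type) (A A' B B' : S -> S).
Hypotheses (AK : cancel A A') (A'K : cancel A' A).
Hypotheses (BK : cancel B B') (B'K : cancel B' B).
Hypothesis BAB : forall s, B' (A (B s)) = iter N A s.

Let step (s : S) (l : bool * bool) : S :=
  match l with
  | (false, false) => A s
  | (false, true) => A' s
  | (true, false) => B s
  | (true, true) => B' s
  end.

Lemma foldl_step_pres u v : pres_eq (BS_rels N) u v ->
  forall s, foldl step s u = foldl step s v.
Proof.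
elim=> {u v} [u v [-> ->]|[[] []]|u u' v v' _ IHu _ IHv|//|u v _ IHu|u v w _ IHu _ IHv] s.
- rewrite /= BAB; elim: N s => //= n IHn s.
  by rewrite -IHn -iterSr.
- exact: B'K.
- exact: BK.
- exact: A'K.
- exact: AK.
- by rewrite !foldl_cat IHu IHv.
- by rewrite IHu.
- by rewrite IHu IHv.
Qed.

(** The orbit map of [s0] under a right action of BS(1,N); the relation [BAB] is
    read backwards because the letters of a word act from left to right. *)
Lemma BS_orbit_map (s0 : S) : exists f : BS N -> S,
  (forall g, f (g * BSa N) = A (f g)) /\ (forall g, f (g * BSb N) = B (f g)).
Proof.
exists (fun g => foldl step s0 (prepr g)).
have gen i (g : BS N) : foldl step s0 (prepr (g * pgen (BS_rels N) i))
    = step (foldl step s0 (prepr g)) (i, false).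
  rewrite -[X in X * _](preprK g) [_ * _]pmul_class.
  by rewrite (foldl_step_pres (prepr_class _ _)) foldl_cat.
by split=> g; rewrite gen.
Qed.

End RightAction.

(** * Vertices forced by their neighbors *)

(** The affine action of BS(1,N) on the rational line: the pair [(q, k)] stands
    for the map [t |-> q + N^k t], so that [q] is the image of 0. *)
Lemma BS_position_height (N : nat) : 0 < N ->
  exists (pos : BS N -> rat) (ht : BS N -> int),
  [/\ forall g, (pos g < pos (g * BSa N)%g)%R,
      forall g, pos (g * BSb N) = pos g &
      forall g, ht (g * BSb N)%g = (ht g + 1)%R].
Proof.
move=> N_gt0; have Ngt0 : (0 < N%:R :> rat)%R by rewrite ltr0n.
have N0 : (N%:R != 0 :> rat)%R by rewrite gt_eqF.
have [||||s|f [fa fb]] := @BS_orbit_map N (rat * int)%type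
  (fun s => (s.1 + N%:R ^ s.2, s.2))%R (fun s => (s.1 - N%:R ^ s.2, s.2))%R
  (fun s => (s.1, s.2 + 1))%R (fun s => (s.1, s.2 - 1))%R _ _ _ _ _ (0, 0)%R.
- by case=> q k /=; rewrite addrK.
- by case=> q k /=; rewrite subrK.
- by case=> q k /=; rewrite addrK.
- by case=> q k /=; rewrite subrK.
- have -> n : iter n (fun s => (s.1 + N%:R ^ s.2, s.2))%R s
      = (s.1 + (N%:R ^ s.2) *+ n, s.2)%R.
    elim: n => [|n IHn]; first by rewrite addr0; case: s.
    by rewrite iterS IHn /= mulrSr addrA.
  by rewrite /= addrK expfzDr // expr1z mulr_natr.
exists (fun g => (f g).1), (fun g => (f g).2); split=> g.
- by rewrite fa /= ltrDl exprz_gt0.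
- by rewrite fb.
- by rewrite fb.
Qed.

Lemma third_color (c d u v : 'I_3) :
  u <> v -> c <> u -> c <> v -> d <> u -> d <> v -> c = d.
Proof.
move=> /eqP + /eqP + /eqP + /eqP + /eqP + ; move=> uv cu cv du dv; apply/eqP.
move: uv cu cv du dv.
by case: c d u v => [[|[|[|c]]] ?] [[|[|[|d]]] ?] [[|[|[|u]]] ?] [[|[|[|v]]] ?].
Qed.

(** If [y] is a finite modification of [x] then the vertex where they differ,
    chosen extremal for position first and height second, is forced to keep its
    color by two neighbors on which [x] and [y] agree. *)
Lemma frozen_of_forcing (N : nat) (x : BS N -> 'I_3) (up : BS N -> bool) :
  0 < N -> C3 x -> (forall g, up (g * BSb N) = up g) ->
  (forall g, x (g * (BSa N)^-1)
     <> x (if up g then g * BSb N else g * (BSb N)^-1)) ->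
  frozen_coloring x.
Proof.
move=> N_gt0 x_col upb x_force; split=> // y y_col [F _ xyF].
have [pos [ht [posa posb htb]]] := BS_position_height N_gt0.
apply/funext => h; apply: contrapT => /eqP yxh.
pose D := [fset g in F | y g != x g]%fset.
have DP g : (g \in D) = (y g != x g).
  rewrite !inE /= andb_idl //; apply: contraR => /xyF ->; exact: eqxx.
have hD : h \in D by rewrite DP.
(* Minimizing m puts v at the top of its column if that column is forced from
   above, and at the bottom otherwise. *)
pose m g : (rat *l int)%type := (pos g, if up g then - ht g else ht g)%R.
have [[v vD] _ v_min] :=
  @Order.TotalTheory.arg_minP _ (rat *l int)%type D [` hD]%fset xpredT
    (fun g => m (val g)) isT.
have agree g : (m g < m v)%O -> y g = x g.
  move=> lt_gv; apply/eqP; apply: contraTT lt_gv; rewrite -DP => gD.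
  by rewrite -leNgt; exact: (v_min [` gD]%fset isT).
set w := if up v then v * BSb N else v * (BSb N)^-1.
have yl : y (v * (BSa N)^-1) = x (v * (BSa N)^-1).
  apply: agree; rewrite /m Order.ProdLexiOrder.ltEprodlexi /=.
  have := posa (v * (BSa N)^-1); rewrite mulgVK => lt_pos.
  by rewrite ltW //= leNgt lt_pos.
have yw : y w = x w.
  apply: agree; rewrite /m Order.ProdLexiOrder.ltEprodlexi /= /w.
  case: ifP => upv; first by rewrite posb upb upv lexx /= htb ltrN2 ltrDl.
  have := posb (v * (BSb N)^-1); have := upb (v * (BSb N)^-1).
  have := htb (v * (BSb N)^-1); rewrite mulgVK => -> <- <-.
  by rewrite upv lexx /= ltrDl.
have col_l (z : BS N -> 'I_3) : C3 z -> z v <> z (v * (BSa N)^-1).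
  by move=> /(_ (v * (BSa N)^-1) (BSa N)); rewrite mulgVK inE eqxx => /(_ isT)/nesym.
have col_w (z : BS N -> 'I_3) : C3 z -> z v <> z w.
  rewrite /w; case: ifP => _ z_col.
    by apply: z_col; rewrite !inE eqxx orbT.
  by have := z_col (v * (BSb N)^-1) (BSb N); rewrite mulgVK !inE eqxx orbT => /(_ isT)/nesym.
have := vD; rewrite DP => /eqP; apply.
apply: (@third_color _ _ (x (v * (BSa N)^-1)) (x w)).
- exact: x_force.
- by rewrite -yl; apply: col_l.
- by rewrite -yw; apply: col_w.
- exact: col_l.
- exact: col_w.
Qed.

(** Forcing along a quotient: when the coloring factors through an orbit map,
    the conditions have to be checked only on the states of the action. *)
Lemma frozen_of_orbit_coloring (N : nat) (S : Type) (A A' B B' : S -> S)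
    (col : S -> 'I_3) (up : S -> bool) (s0 : S) :
  0 < N -> cancel A A' -> cancel A' A -> cancel B B' -> cancel B' B ->
  (forall s, B' (A (B s)) = iter N A s) ->
  (forall s, col s != col (A s)) -> (forall s, col s != col (B s)) ->
  (forall s, up (B s) = up s) ->
  (forall s, col (A' s) != col (if up s then B s else B' s)) ->
  exists x : BS N -> 'I_3, frozen_coloring x.
Proof.
move=> N_gt0 AK A'K BK B'K BAB colA colB upB force.
have [f [fa fb]] := BS_orbit_map AK A'K BK B'K BAB s0.
have fa' g : f (g * (BSa N)^-1) = A' (f g) by rewrite -{2}(mulgVK (BSa N) g) fa AK.
have fb' g : f (g * (BSb N)^-1) = B' (f g) by rewrite -{2}(mulgVK (BSb N) g) fb BK.
exists (col \o f); apply: (frozen_of_forcing (up := up \o f)) => //.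
- move=> g s; rewrite !inE => /orP[] /eqP -> /=; first by rewrite fa; apply/eqP.
  by rewrite fb; apply/eqP.
- by move=> g /=; rewrite fb.
- move=> g /=; have := force (f g); case: (up _); first by rewrite fa' fb => /eqP.
  by rewrite fa' fb' => /eqP.
Qed.

(** * Frozen colorings *)

(** The state [(t, e)] records [g . 0] modulo 3 and the parity of the height:
    [a] adds [2^ht = (-1)^ht] to [t].  Both vertical neighbors have the color
    [col + (-1)^ht], and the left one [col - (-1)^ht], so that every vertex can be
    forced from above. *)
Lemma frozen_BS2 : exists x : BS 2 -> 'I_3, frozen_coloring x.
Proof.
apply: (@frozen_of_orbit_coloring 2 ('I_3 * bool)%type
  (fun s => (if s.2 then s.1 - 1 else s.1 + 1, s.2))%R
  (fun s => (if s.2 then s.1 + 1 else s.1 - 1, s.2))%R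
  (fun s => (s.1, ~~ s.2)) (fun s => (s.1, ~~ s.2))
  (fun s => if s.2 then s.1 + 1 else s.1)%R xpredT (0%R, false)) => //.
- by case=> t [] /=; rewrite ?subrK ?addrK.
- by case=> t [] /=; rewrite ?subrK ?addrK.
- by case=> t [].
- by case=> t [].
- by case=> -[[|[|[|]]] // ?] [] /=; congr (_, _); apply/val_inj.
- by case=> -[[|[|[|]]] // ?] [].
- by case=> -[[|[|[|]]] // ?] [].
- by case=> -[[|[|[|]]] // ?] [].
Qed.

(** Alternating colors 0 and 1; the last vertex gets color 2 so that the cycle
    closes up even when its length is odd. *)
Definition cycle_color (m : nat) (p : 'I_m.+2) : 'I_3 :=
  if p == ord_max then inord 2 else inord (odd p).

Lemma cycle_color_proper (m : nat) (p : 'I_m.+2) :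
  cycle_color p != cycle_color (p + 1)%R.
Proof.
rewrite /cycle_color -!val_eqE /=.
have [pm|pm] := eqVneq (p : nat) m.+1.
  rewrite pm [1 %% _]modn_small // addn1 modnn /=.
  by rewrite !inordK.
have lt_pm : p < m.+1 by rewrite ltn_neqAle pm -ltnS /=.
rewrite [1 %% _]modn_small // modn_small addn1 //.
by case: (p.+1 == m.+1); rewrite !inordK //=; case: (odd p).
Qed.

(** The state [(k, p)] is the height modulo 3 together with the exponent of [a]
    modulo [N - 1 = m.+2]. *)
Lemma frozen_BS_ge3 (m : nat) : exists x : BS m.+3 -> 'I_3, frozen_coloring x.
Proof.
pose cc := @cycle_color m.
apply: (@frozen_of_orbit_coloring m.+3 ('I_3 * 'I_m.+2)%type
  (fun s => (s.1, s.2 + 1))%R (fun s => (s.1, s.2 - 1))%R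
  (fun s => (s.1 + 1, s.2))%R (fun s => (s.1 - 1, s.2))%R
  (fun s => s.1 + cc s.2)%R
  (fun s => cc (s.2 - 1) != cc s.2 + 1)%R (0%R, 0%R)) => //.
- by case=> k p /=; rewrite addrK.
- by case=> k p /=; rewrite subrK.
- by case=> k p /=; rewrite addrK.
- by case=> k p /=; rewrite subrK.
- case=> k p.
  have -> n : iter n (fun s => (s.1, s.2 + 1))%R (k, p) = (k, p + n%:R)%R.
    elim: n => [|n IHn]; first by rewrite addr0.
    by rewrite iterS IHn /= mulrSr addrA.
  by rewrite mulrS (pchar_Zp (p := m.+2)) // addr0 /= addrK.
- by case=> k p /=; rewrite (inj_eq (addrI k)) cycle_color_proper.
- by case=> k p /=; rewrite addrAC -subr_eq0 opprD addNKr.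
- case=> k p /=; case: ifP => [|/negbFE/eqP].
    by rewrite /= -addrA (inj_eq (addrI k)) [(1 + _)%R]addrC.
  move=> -> /=; rewrite -addrA (inj_eq (addrI k)) addrC.
  by rewrite (inj_eq (addrI _)).
Qed.

Lemma frozen_exists (N : nat) : 2 <= N ->
  exists x : BS N -> 'I_3, frozen_coloring x.
Proof.
by case: N => [|[|[|m]]] // _; [apply: frozen_BS2 | apply: frozen_BS_ge3].
Qed.

(** * Failure of strong irreducibility *)

Lemma restrict_eq_on (G : groupType) (A : finType) (x z : G -> A) (D : {fset G}) :
  restrict z (domf (restrict x D)) = restrict x D ->
  forall g, g \in D -> z g = x g.
Proof.
move=> zx g gD; have /(congr1 (fun p : {fmap G -> A} => p.[? g]%fmap)) := zx.
by rewrite !in_fnd // => -[]; rewrite !ffunE.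
Qed.

(** Let [K] be a finite set containing the identity and the gluing set [F].  A
    coloring that agrees with [x] on the boundary of [K] and not at the identity
    can be cut along that boundary and replaced by [x] outside [K]. *)
Lemma frozen_not_strongly_irreducible (N : nat) (x : BS N -> 'I_3) :
  frozen_coloring x -> ~ strongly_irreducible (@C3 N).
Proof.
move=> [x_col x_frozen] [F glue].
have [K K1 FK] : exists2 K : {fset BS N}, 1%g \in K & {subset F <= K}.
  by exists (1%g |` F)%fset => [|g gF]; rewrite !inE ?eqxx ?gF ?orbT.
pose gens := [:: BSa N; BSb N].
(* D is the outer boundary of K in the Cayley graph. *)
pose D := [fset h in [fset (g * s) | g in K, s in gens ++ [seq s^-1 | s <- gens]] |
             h \notin K]%fset.
pose x' g := (x g + 1)%R.
have x'_col : C3 x' by move=> g s /(x_col g) xs /addIr.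
have [z [[z_col zx] [_ zx']]] : (cylinder (@C3 N) (restrict x D)
    `&` cylinder (@C3 N) (restrict x' [fset 1%g]%fset) !=set0)%classic.
  apply: glue; [by exists x | by exists x' |].
  apply/fsetP => g; rewrite !inE /=; apply/negP => /andP[/andP[_ gK]].
  case/imfset2P => u; rewrite !inE => /eqP -> [h hF gh].
  by move: gK; rewrite gh mul1g FK.
have {zx} zx := restrict_eq_on zx; have {zx'} zx' := restrict_eq_on zx'.
(* Edges leaving K end in D, where z and x agree, so the cut is proper. *)
pose y g := if g \in K then z g else x g.
have bd g s t : g \in K -> s \in gens ++ [seq s^-1 | s <- gens] -> g * s = t ->
    t \notin K -> z t = x t.
  move=> gK sg <- tK; apply: zx; rewrite !inE /= tK andbT.
  by apply/imfset2P; exists g => //; exists s.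
have y_col : C3 y.
  move=> g s sg; rewrite /y; case: ifP => gK; case: ifP => gsK.
  - exact: z_col.
  - rewrite -(bd g s) ?gsK ?mem_cat ?sg //; exact: z_col.
  - rewrite -(bd (g * s) s^-1 g) ?gK ?mulgK //; first exact: z_col.
    by rewrite mem_cat (map_f (fun s => s^-1) sg) orbT.
  - exact: x_col.
have yx : y = x.
  apply: x_frozen => //; exists K; last by move=> g /negbTE gK; rewrite /y gK.
  by apply/fset0Pn; exists 1%g.
have := congr1 (fun c => c 1%g) yx; rewrite /y K1 zx' ?inE //.
by rewrite /x'; case: (x 1%g) => [[|[|[|]]]].
Qed.

Theorem theorem4p7 (N : nat) (hN : 2 <= N) :
  (exists x : BS N -> 'I_3, frozen_coloring x) /\
  ~ strongly_irreducible (@C3 N).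
Proof.
have [x x_frozen] := frozen_exists hN.
by split; [exists x | apply: frozen_not_strongly_irreducible x_frozen].
Qed.
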